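(* Consider a tensor network with $n$ leaves, of which $n_c \ge 1$ are green (complex) and $n_r = n - n_c$ are real. Every binary contraction tree over the network has exactly $n_c - 1$ merge steps and exactly $n_r$ non-merge steps (rides and passes combined). Only the split of the $n_r$ non-merge steps into rides and passes, and the volumes carried by the steps, depend on the tree (in particular, there exist networks having two binary contraction trees with different numbers of rides).
   Context: A tensor network is a finite collection of tensors (leaves) whose axes are labelled by indices with dimensions; each leaf is either green (complex) or real. A binary contraction tree is a full binary tree whose leaves are the tensors of the network; each internal node is a pairwise contraction step whose two operands are the (intermediate or leaf) tensors at its two children. An operand is green if and only if its subtree contains at least one green leaf. A step is a merge if both operands are green, a ride if exactly one operand is green, and a pass if neither is green. The volume of a step is the product of the dimensions of all indices occurring on at least one of its two operands. *)

(* Defs.v *)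
From mathcomp Require Import all_boot.

Set Implicit Arguments.
Unset Strict Implicit.
Unset Printing Implicit Defensive.

(* Only the labelled structure of the network is kept, not the numerical
   entries of the tensors.  An index may label any number of axes, including
   several axes of the same tensor; [tn_output] lists the indices that must
   survive on the final tensor. *)
Record tensor_network := TensorNetwork {
  tn_leaf : finType;
  tn_index : finType;
  tn_axes : tn_leaf -> seq tn_index;
  tn_dim : tn_index -> nat;
  tn_dim_gt0 : forall i, 0 < tn_dim i;
  tn_green : {set tn_leaf};
  tn_output : {set tn_index} }.

Inductive btree (T : Type) : Type :=
| BLeaf of T
| BNode of btree T & btree T.

Arguments BLeaf {T} _.
Arguments BNode {T} _ _.

Fixpoint bleaves (T : Type) (t : btree T) : seq T :=
  match t with
  | BLeaf x => [:: x]
  | BNode l r => bleaves l ++ bleaves r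
  end.

(* One step per internal node, given by the subtrees of its two operands. *)
Fixpoint steps (T : Type) (t : btree T) : seq (btree T * btree T) :=
  match t with
  | BLeaf _ => [::]
  | BNode l r => (l, r) :: steps l ++ steps r
  end.

Definition contraction_tree (N : tensor_network) (t : btree (tn_leaf N)) :=
  perm_eq (bleaves t) (enum (tn_leaf N)).

Section Steps.
Variable N : tensor_network.
Implicit Types (t : btree (tn_leaf N)).
Implicit Types (s : btree (tn_leaf N) * btree (tn_leaf N)).

Definition green_operand t := has [in tn_green N] (bleaves t).

Definition is_merge s := green_operand s.1 && green_operand s.2.
Definition is_ride s := green_operand s.1 (+) green_operand s.2.
Definition is_pass s := ~~ green_operand s.1 && ~~ green_operand s.2.

Definition num_merges t := count is_merge (steps t).
Definition num_nonmerges t := count (predC is_merge) (steps t).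
Definition num_rides t := count is_ride (steps t).
Definition num_passes t := count is_pass (steps t).

(* A pairwise contraction sums over exactly those indices of its operands that
   are neither output indices nor present on a leaf outside the subtree. *)
Fixpoint operand_indices t : {set tn_index N} :=
  match t with
  | BLeaf x => [set i in tn_axes x]
  | BNode l r =>
      [set i in operand_indices l :|: operand_indices r |
        (i \in tn_output N) ||
        [exists x, (x \notin bleaves (BNode l r)) && (i \in tn_axes x)]]
  end.

Definition volume s : nat :=
  \prod_(i in operand_indices s.1 :|: operand_indices s.2) tn_dim i.

Definition step_volumes t : seq nat := map volume (steps t).

End Steps.

(* Main.v *)
(** Green operands behave additively: [a + b = (a && b) + (a || b)] for booleans,
    so each merge loses exactly one green operand and every other step keeps
    their number, while the total number of operands drops by one per step. *)
Require Import Defs.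
From mathcomp Require Import all_boot.

(** Reading [green_operand t] as 0 or 1 counts the green operands left at the root, so the induction
    also covers subtrees without green leaves. *)
Lemma num_merges_green {N : tensor_network} (t : btree (tn_leaf N)) :
  num_merges t + green_operand t = count [in tn_green N] (bleaves t).
Proof.
rewrite /num_merges; elim: t => [x|l IHl r IHr] /=.
  by rewrite /green_operand /= orbF addn0.
have -> : green_operand (BNode l r) = green_operand l || green_operand r.
  exact: has_cat.
rewrite !count_cat -IHl -IHr [RHS]addnACA [X in X + _]addnC -addnA; congr (_ + _).
by rewrite /is_merge /=; do 2!case: green_operand.
Qed.

Lemma size_steps {T : Type} (t : btree T) : (size (steps t)).+1 = size (bleaves t).
Proof.
by elim: t => //= l IHl r IHr; rewrite !size_cat -IHl -IHr addSn addnS.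
Qed.

Lemma num_rides_passes {N : tensor_network} (t : btree (tn_leaf N)) :
  num_rides t + num_passes t = num_nonmerges t.
Proof.
(* Inclusion-exclusion: the union of rides and passes is the non-merges, and the intersection is
   empty. *)
rewrite /num_rides /num_passes /num_nonmerges -count_predUI.
rewrite [X in _ + X](@eq_count _ _ pred0) ?count_pred0 ?addn0 => [|s].
  apply: eq_count => s /=; rewrite /is_ride /is_pass /is_merge.
  by do 2!case: green_operand.
by rewrite /= /is_ride /is_pass; do 2!case: green_operand.
Qed.

Lemma contraction_tree_count {N : tensor_network} {t : btree (tn_leaf N)} :
    contraction_tree t -> 0 < #|tn_green N| ->
  num_merges t = #|tn_green N| - 1 /\
  num_nonmerges t = #|tn_leaf N| - #|tn_green N|.
Proof.
move=> tN gN; have size_t := size_steps t.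
have cardG : count [in tn_green N] (bleaves t) = #|tn_green N|.
  by rewrite (permP tN) -size_filter enumT cardE.
(* A green leaf makes the root operand green; this is the 1 in [#|tn_green N| - 1]. Successor forms
   avoid truncated subtraction. *)
have mergesE : (num_merges t).+1 = #|tn_green N|.
  have := num_merges_green t; rewrite /green_operand has_count cardG gN.
  by rewrite addn1.
have leavesE : (num_merges t + num_nonmerges t).+1 = #|tn_leaf N|.
  by rewrite count_predC size_t (perm_size tN) -cardE.
by rewrite -mergesE -leavesE subSS subn0 subSS addKn.
Qed.

(* The leaves are one green and one real scalar, [None] and [Some true], and a
   real vector of dimension 2, [Some false]. *)
Definition two_scalars_vector : tensor_network :=
  @TensorNetwork (option bool) unit
    (fun x => if x is Some false then [:: tt] else [::])
    (fun=> 2) (fun=> isT) [set None] setT.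

(** The green leaf enters at once, so both steps are rides. *)
Definition green_first : btree (tn_leaf two_scalars_vector) :=
  BNode (BNode (BLeaf None) (BLeaf (Some true))) (BLeaf (Some false)).

(** The real leaves meet first: a pass, then a ride. *)
Definition green_last : btree (tn_leaf two_scalars_vector) :=
  BNode (BLeaf None) (BNode (BLeaf (Some true)) (BLeaf (Some false))).

Lemma green_first_contraction : contraction_tree green_first.
Proof. by apply: uniq_perm; rewrite ?enum_uniq // => -[[]|]; rewrite mem_enum. Qed.

Lemma green_last_contraction : contraction_tree green_last.
(* Both trees list the leaves in the same order, so the statements are convertible. *)
Proof. exact: green_first_contraction. Qed.

Lemma num_rides_green_first : num_rides green_first = 2.
Proof. by rewrite /num_rides /= /is_ride /green_operand /= !inE. Qed.

Lemma num_rides_green_last : num_rides green_last = 1.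
Proof. by rewrite /num_rides /= /is_ride /green_operand /= !inE. Qed.

(** With [tt] as the only index, the product is either 2 or empty. *)
Lemma volume_two_scalars_vector
    (s : btree (tn_leaf two_scalars_vector) * btree (tn_leaf two_scalars_vector)) :
  volume s =
    if (tt \in operand_indices s.1) || (tt \in operand_indices s.2) then 2 else 1.
Proof. by rewrite /volume big_mkcond (big_pred1 tt) ?inE // => -[]. Qed.

Lemma step_volumes_green_first : step_volumes green_first = [:: 2; 1].
Proof. by rewrite /step_volumes /= !volume_two_scalars_vector /= !inE. Qed.

(** The output index [tt] survives the inner step, so the root step carries it too. *)
Lemma step_volumes_green_last : step_volumes green_last = [:: 2; 2].
Proof. by rewrite /step_volumes /= !volume_two_scalars_vector /= !inE. Qed.

Theorem proposition5 :
  (forall (N : tensor_network) (n n_c n_r : nat),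
     #|tn_leaf N| = n -> #|tn_green N| = n_c -> n_r = n - n_c -> 1 <= n_c ->
     forall t : btree (tn_leaf N), contraction_tree t ->
       [/\ num_merges t = n_c - 1,
           num_nonmerges t = n_r
         & num_rides t + num_passes t = n_r])
  /\ (exists (N : tensor_network) (t1 t2 : btree (tn_leaf N)),
        [/\ 1 <= #|tn_green N|, contraction_tree t1, contraction_tree t2
          & num_rides t1 <> num_rides t2])
  /\ (exists (N : tensor_network) (t1 t2 : btree (tn_leaf N)),
        [/\ 1 <= #|tn_green N|, contraction_tree t1, contraction_tree t2
          & ~~ perm_eq (step_volumes t1) (step_volumes t2)]).
Proof.
have green_gt0 : 0 < #|tn_green two_scalars_vector| by rewrite cards1.
have first := green_first_contraction; have last := green_last_contraction.
split=> [N n n_c n_r <- <- -> gN t tN|].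
  by have [merges nonmerges] := contraction_tree_count tN gN; rewrite num_rides_passes.
split; exists two_scalars_vector, green_first, green_last; split=> //.
  by rewrite num_rides_green_first num_rides_green_last.
by rewrite step_volumes_green_first step_volumes_green_last.
Qed.
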